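(* Let $\widehat{A}$ be an $n\times n$ dual matrix. If a dual core generalized inverse of $\widehat{A}$ exists, then it is unique; that is, there is at most one $n\times n$ dual matrix $\widehat{G}$ satisfying $\widehat{A}\widehat{G}\widehat{A}=\widehat{A}$, $\widehat{A}\widehat{G}^2=\widehat{G}$ and $(\widehat{A}\widehat{G})^{T}=\widehat{A}\widehat{G}$.
   Context: Dual numbers are $a+\varepsilon a'$ with $a,a'\in\mathbb{R}$ and $\varepsilon\neq 0$, $\varepsilon^2=0$ (i.e. the ring $\mathbb{R}[\varepsilon]/(\varepsilon^2)$). A dual matrix is a matrix over dual numbers, written $\widehat{A}=A+\varepsilon B$ with $A,B$ real; its transpose is $\widehat{A}^{T}=A^{T}+\varepsilon B^{T}$. A dual core generalized inverse (DCGI) of an $n\times n$ dual matrix $\widehat{A}$ is an $n\times n$ dual matrix $\widehat{G}$ satisfying the three equations in the statement. *)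

(* Defs.v *)
From mathcomp Require Import all_boot all_order all_algebra.
From mathcomp Require Import reals.

Set Implicit Arguments.
Unset Strict Implicit.
Unset Printing Implicit Defensive.

Import GRing.Theory.
Local Open Scope ring_scope.

(* Dual numbers as the quotient ring R[X] / (X^2), where epsilon is the class
   of X.  {poly %/ h} falls back to R[X] / (X) when h is not monic of
   positive degree; this does not happen for h = 'X^2 (see mk_monic_Xn). *)
Notation dual R := {poly %/ ('X^2 : {poly R})}.

Definition eps {R : realType} : dual R := 'qX.

Definition to_dual {R : realType} (a : R) : dual R := qpolyC 'X^2 a.

Definition dual_mx (R : realType) (m n : nat) (A B : 'M[R]_(m, n)) :
    'M[dual R]_(m, n) :=
  map_mx to_dual A + eps *: map_mx to_dual B.

Definition is_dcgi (R : realType) (n : nat) (A G : 'M[dual R]_n) : Prop :=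
  [/\ A *m G *m A = A, A *m (G *m G) = G & (A *m G)^T = A *m G].

(* The quotient ring agrees with the description by pairs a + eps a'. *)
Section DualFacts.
Variable R : realType.

Lemma val_eps : (eps : dual R) = 'X :> {poly R}.
Proof. by rewrite /eps qpolyXE ?size_polyXn ?monicXn. Qed.

Lemma eps_neq0 : (eps : dual R) != 0.
Proof.
by apply/eqP => /(congr1 (@polyn _ _)) /eqP; rewrite val_eps polyX_eq0.
Qed.

Lemma eps_sqr : (eps : dual R) ^+ 2 = 0.
Proof.
apply: val_inj; rewrite [LHS]poly_of_qpolyX val_eps.
by rewrite [X in Pdiv.CommonRing.rmodp _ X]mk_monic_Xn
  Pdiv.RingMonic.rmodpp ?monicXn.
Qed.

Lemma val_dual (a b : R) :
  to_dual a + eps * to_dual b = a%:P + 'X * b%:P :> {poly R}.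
Proof.
rewrite poly_of_qpolyD poly_of_qpolyM val_eps /= mk_monic_Xn.
rewrite Pdiv.CommonRing.rmodp_small //.
rewrite size_polyXn; apply: (leq_ltn_trans (size_polyMleq _ _)).
by rewrite size_polyX size_polyC; case: (b != 0).
Qed.

Lemma dual_inj (a b c d : R) :
  to_dual a + eps * to_dual b = to_dual c + eps * to_dual d -> a = c /\ b = d.
Proof.
move=> /(congr1 (@polyn _ _)); rewrite !val_dual => /polyP e.
by split; [have := e 0%N | have := e 1%N];
  rewrite !coefD !coefXM !coefC /= ?addr0 ?add0r.
Qed.

Lemma dualP (x : dual R) : x = to_dual x`_0 + eps * to_dual x`_1.
Proof.
apply: val_inj; rewrite [RHS]val_dual; apply/polyP => i.
rewrite coefD coefXM !coefC; case: i => [|[|i]] /=; rewrite ?addr0 ?add0r //.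
by rewrite nth_default // (leq_trans (size_npoly x)) // mk_monic_Xn size_polyXn.
Qed.

Lemma dual_mxP (m n : nat) (A : 'M[dual R]_(m, n)) :
  exists A1 A2 : 'M[R]_(m, n), A = dual_mx A1 A2.
Proof.
exists (\matrix_(i, j) (A i j)`_0), (\matrix_(i, j) (A i j)`_1).
by apply/matrixP => i j; rewrite !mxE -dualP.
Qed.

Lemma dual_mx_tr (m n : nat) (A B : 'M[R]_(m, n)) :
  (dual_mx A B)^T = dual_mx A^T B^T.
Proof. by apply/matrixP => i j; rewrite !mxE. Qed.

End DualFacts.

(* Main.v *)
(** If G and H are two DCGIs of A, then AG and AH are symmetric idempotents
    with the same range, hence both equal one matrix P.  Since PA = A and
    PG = G, the matrix N = GP + (1 - P) is a right inverse of
    M = AP + (1 - P), hence, over a commutative ring, also a left inverse.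
    Finally MG = P = MH, so G = NP = H. *)
Require Import Defs.
From mathcomp Require Import all_boot all_order all_algebra.
From mathcomp Require Import reals.

Local Open Scope ring_scope.
Import GRing.Theory.

Lemma sym_range_proj_uniq {S : comNzRingType} {n : nat} {A G H : 'M[S]_n} :
  A *m G *m A = A -> A *m H *m A = A ->
  (A *m G)^T = A *m G -> (A *m H)^T = A *m H -> A *m G = A *m H.
Proof.
move=> AGA AHA symG symH.
have PQ : A *m G *m (A *m H) = A *m H by rewrite mulmxA AGA.
have QP : A *m H *m (A *m G) = A *m G by rewrite mulmxA AHA.
(* Transposing [QP] reverses its product: [A *m G] becomes [A *m G *m (A *m H)], which is [A *m H]
   by [PQ]. *)
by rewrite -symG -QP trmx_mul symG symH.
Qed.

Lemma outer_square_eq {S : comNzRingType} {n : nat} {A G H : 'M[S]_n} :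
  A *m G *m A = A -> A *m (G *m G) = G -> A *m (H *m H) = H ->
  A *m G = A *m H -> G = H.
Proof.
move=> AGA AGG AHH AGH; set P := A *m G.
(* Such an [X] has its columns in the range of [A], which [P] fixes. *)
have fixP (X : 'M_n) : A *m (X *m X) = X -> P *m X = X.
  by move=> AXX; rewrite -[in LHS]AXX mulmxA AGA.
have PG := fixP _ AGG; have PH := fixP _ AHH.
have PP : P *m P = P by rewrite /P mulmxA AGA.
(* [A] may be singular; [M] keeps its action on the range of [P] and is padded by the complementary
   projection to become invertible. *)
pose M := A *m P + (1%:M - P); pose N := G *m P + (1%:M - P).
have MX (X : 'M_n) : P *m X = X -> M *m X = A *m X.
  by move=> PX; rewrite mulmxDl mulmxBl -mulmxA PX mul1mx subrr addr0.
have MN : M *m N = 1%:M.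
  have PGP : P *m (G *m P) = G *m P by rewrite mulmxA PG.
  have AGP : A *m (G *m P) = P by rewrite mulmxA.
  (* [M] sends [G *m P] to [P] and fixes [1%:M - P], as [P *m (1%:M - P)] vanishes. *)
  rewrite mulmxDr MX // AGP mulmxDl -mulmxA !mulmxBr !mulmxBl !mulmx1 !mul1mx PP.
  by rewrite !subrr add0r subr0 addrC subrK.
have NM := mulmx1C MN.
by rewrite -[G]mul1mx -[H]mul1mx -NM -!mulmxA (MX _ PG) (MX _ PH) AGH.
Qed.

Theorem theorem3p2 (R : realType) (n : nat) (A G H : 'M[dual R]_n) :
  is_dcgi A G -> is_dcgi A H -> G = H.
Proof.
move=> [AGA AGG symG] [AHA AHH symH].
exact: outer_square_eq AGA AGG AHH (sym_range_proj_uniq AGA AHA symG symH).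
Qed.
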